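(* Let $p>q\geq 1$ be integers, $m=p+q$, and let $U=\mathbb{C}^m$ with standard coordinates $z_1,\dots,z_m$ and the hermitian form $(u,u)=\sum_{i=1}^p|z_i|^2-\sum_{i=p+1}^m|z_i|^2$; write $u_1,\dots,u_m$ for the standard basis. Let $\varphi_{\mathrm{KM}}\in\mathscr{S}(U^p)$ be the Kudla–Millson Schwartz function described in the context, and for $j=1,\dots,q$ put $e_j=\frac{u_j+u_{m+1-j}}{\sqrt2}$, and let $U'=\mathrm{Span}_{\mathbb{C}}\{u_{q+1},\dots,u_p\}$. Then for every $x=(x^{(1)},\dots,x^{(p)})\in U'^p$, $$\int_{(\mathbb{C}^q)^p}\varphi_{\mathrm{KM}}\Big(\big(\textstyle\sum_{k=1}^q y^{(j)}_k e_k + x^{(j)}\big)_{j=1,\dots,p}\Big)\,dy=0,$$ where $dy$ is Lebesgue measure on $(\mathbb{C}^{q})^p$, $y=(y^{(j)}_k)$. That is, $\varphi_{\mathrm{KM}}$ lies in the kernel of the (archimedean) Ikeda map $\mathscr{S}(U^p)\to\mathscr{S}(U'^p)$.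
   Context: Set $f_j=\frac{u_j-u_{m+1-j}}{\sqrt2}$ for $1\le j\le q$; then $U=V''_e\oplus U'\oplus V''_f$ with $V''_e=\mathrm{Span}\{e_j\}$, $V''_f=\mathrm{Span}\{f_j\}$ isotropic, $(e_i,f_j)=\delta_{ij}$, and the Ikeda map sends $\Psi\in\mathscr{S}(U^p)$ to $x\mapsto\int_{(V''_e)^p}\Psi(y+x+0)\,dy$. Definition of $\varphi_{\mathrm{KM}}$: let $\Lambda$ be the exterior algebra over $\mathbb{C}$ of a $2pq$-dimensional space with basis $\{\xi_{jk},\overline{\xi_{jk}}:1\le j\le p,\ 1\le k\le q\}$. Let $\varphi_0=\exp(-\pi\sum_{i=1}^m|z_i|^2)$. Define operators on $\Lambda\otimes\mathscr{S}(U)$ $$D^+=2^{-2q}\prod_{k=1}^q\sum_{j=1}^p \xi_{jk}\otimes\Big(\overline{z_j}-\tfrac1\pi\tfrac{\partial}{\partial z_j}\Big),\qquad \overline{D^+}=2^{-2q}\prod_{k=1}^q\sum_{j=1}^p \overline{\xi_{jk}}\otimes\Big(z_j-\tfrac1\pi\tfrac{\partial}{\partial \overline{z_j}}\Big),$$ where $\xi\otimes P$ acts by left exterior multiplication by $\xi$ on the first factor and by the differential operator $P$ on the second, and set $\varphi^+_{q,q}=D^+\overline{D^+}(1\otimes\varphi_0)$, a $\Lambda$-valued Schwartz function on $U$. Define the $\Lambda$-valued function on $U^p$: $\varphi^+_{pq,pq}(u^{(1)},\dots,u^{(p)})=\varphi^+_{q,q}(u^{(1)})\wedge\cdots\wedge\varphi^+_{q,q}(u^{(p)})$;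 it takes values in the one-dimensional top degree $\Lambda^{2pq}$, spanned by $\omega\wedge\overline{\omega}$ with $\omega=\xi_{11}\wedge\xi_{21}\wedge\cdots\wedge\xi_{p1}\wedge\xi_{12}\wedge\cdots\wedge\xi_{p2}\wedge\cdots\wedge\xi_{1q}\wedge\cdots\wedge\xi_{pq}$ and $\overline\omega$ the same product of the $\overline{\xi_{jk}}$. Then $\varphi_{\mathrm{KM}}\in\mathscr{S}(U^p)$ is defined by $\varphi^+_{pq,pq}=(\omega\wedge\overline\omega)\,\varphi_{\mathrm{KM}}$. *)

(* Defs.v *)
From HB Require Import structures.
From mathcomp Require Import all_boot all_order all_algebra.

Set Implicit Arguments.
Unset Strict Implicit.
Unset Printing Implicit Defensive.
Import Order.TTheory GRing.Theory Num.Theory.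

Local Open Scope ring_scope.

(* Exterior algebra of the free K-module on a finite set I of generators.   *)
(* An element is the family of its coordinates in the basis (e_A), A a      *)
(* subset of I, where e_A is the product of the generators in A taken in    *)
(* the order given by enum_rank; e_B e_C = 0 unless B and C are disjoint,   *)
(* and then e_B e_C = (-1)^(inversions B C) e_(B u C).                      *)

Notation extalg K I := {ffun {set I} -> K^o}.

Section ExteriorAlgebra.
Context {K : comNzRingType} {I : finType}.
Implicit Types (A B : {set I}) (x y : extalg K I).

Definition inversions A B : nat :=
  #|[set bc in setX A B | (enum_rank bc.2 < enum_rank bc.1)%N]|.

Definition ext_basis A : extalg K I := [ffun B => (B == A)%:R].

Definition ext_one : extalg K I := ext_basis set0.

Definition ext_gen (i : I) : extalg K I := ext_basis [set i].

Definition wedge x y : extalg K I :=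
  [ffun A : {set I} => \sum_(B : {set I} | B \subset A)
     (-1) ^+ inversions B (A :\: B) * x B * y (A :\: B)].

Definition ext_homog n x := forall A, #|A| != n -> x A = 0.

Lemma ext_homog_basis A : ext_homog #|A| (ext_basis A).
Proof.
by move=> B; rewrite ffunE; have [->|] := eqVneq B A; rewrite ?eqxx.
Qed.

Lemma ext_homog_one : ext_homog 0 ext_one.
Proof. by have := @ext_homog_basis set0; rewrite cards0. Qed.

Lemma ext_homog_wedge m n x y :
  ext_homog m x -> ext_homog n y -> ext_homog (m + n)%N (wedge x y).
Proof.
move=> hx hy A cA; rewrite ffunE big1// => B BA.
have [cB|/hx->] := eqVneq #|B| m; last by rewrite mulr0 mul0r.
rewrite [y _]hy ?mulr0// cardsD (setIidPr BA) cB.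
by apply: contra cA => /eqP <-; rewrite -cB subnKC ?subset_leq_card.
Qed.

Lemma ext_homog_sum (J : finType) n (F : J -> extalg K I) :
  (forall j, ext_homog n (F j)) -> ext_homog n (\sum_j F j).
Proof. by move=> hF A cA; rewrite sum_ffunE big1// => j _; exact: hF. Qed.

Lemma ext_homogZ n (a : K) x : ext_homog n x -> ext_homog n (a *: x).
Proof. by move=> hx A cA; rewrite ffunE hx// scaler0. Qed.

Definition signed_basis A x := exists n, x = (-1) ^+ n *: ext_basis A.

Lemma signed_basis_wedge A B x y : [disjoint A & B] ->
  signed_basis A x -> signed_basis B y ->
  signed_basis (A :|: B) (wedge x y).
Proof.
move=> dAB [m ->] [n ->]; exists (inversions A B + m + n)%N.
have AB : ((A :|: B) :\: A = B).
  by rewrite setDUl setDv set0U; apply/setDidPl;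
     rewrite disjoint_sym.
apply/ffunP => D; rewrite !ffunE.
have [->|nD] := eqVneq D (A :|: B).
  rewrite (bigD1 A) ?subsetUl//= big1 => [|E /andP[_ EA]].
    by rewrite !ffunE AB !eqxx addr0 /GRing.scale/= !mulr1 !exprD.
  by rewrite !ffunE (negbTE EA) scaler0 mulr0 mul0r.
rewrite scaler0 big1// => E ED; rewrite !ffunE.
have [EA|] := eqVneq E A; last by rewrite scaler0 mulr0 mul0r.
have [DB|] := eqVneq (D :\: E) B; last by rewrite scaler0 mulr0.
by move: nD; rewrite -DB -EA -[X in X != _](setID D E) (setIidPr ED) eqxx.
Qed.

Lemma signed_basis_big (J : finType) (S : J -> {set I}) (F : J -> extalg K I) :
  (forall i j, i != j -> [disjoint S i & S j]) ->
  (forall j, signed_basis (S j) (F j)) ->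
  signed_basis (\bigcup_j S j) (\big[wedge/ext_one]_j F j).
Proof.
move=> dS hF; elim: (index_enum J) (index_enum_uniq J) => [|j r ih] /=.
  by move=> _; rewrite !big_nil; exists 0%N; rewrite expr0 scale1r.
move=> /andP[jr /ih{}ih]; rewrite !big_cons; apply: signed_basis_wedge => //.
rewrite disjoint_sym -setI_eq0 big_distrl /=; apply/eqP; rewrite big1_seq//.
move=> i /andP[_ ir]; apply/eqP; rewrite setI_eq0; apply: dS.
by apply: contra jr => /eqP <-.
Qed.

End ExteriorAlgebra.

From mathcomp Require Import complex.
From mathcomp Require Import all_classical all_reals all_analysis.
Import numFieldNormedType.Exports.

Local Open Scope classical_set_scope.
Local Open Scope complex_scope.
Local Open Scope ring_scope.

Section ProductSigmaFinite.
Local Open Scope ereal_scope.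
Context d1 d2 (T1 : measurableType d1) (T2 : measurableType d2) (R : realType).
Variables (m1 : {sigma_finite_measure set T1 -> \bar R})
          (m2 : {sigma_finite_measure set T2 -> \bar R}).

(* The library's canonical instance for this fact is shadowed by the one    *)
(* for products of subprobabilities.                                        *)
Lemma product_sigma_finite : sigma_finite setT (m1 \x m2).
Proof.
have /sigma_finiteP[F [TF ndF Foo]] := sigma_finiteT m1.
have /sigma_finiteP[G [TG ndG Goo]] := sigma_finiteT m2.
exists (fun n => F n `*` G n).
  rewrite -setXTT TF TG predeqE => -[x y]; split.
    move=> [/= [n _ Fnx] [k _ Gky]]; exists (maxn n k) => //; split.
    - by move: x Fnx; exact/subsetPset/ndF/leq_maxl.
    - by move: y Gky; exact/subsetPset/ndG/leq_maxr.
  by move=> [n _ []/= ? ?]; split; exists n.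
move=> k; have [? ?] := Foo k; have [? ?] := Goo k.
split; first exact: measurableX.
by rewrite product_measure1E// lte_mul_pinfty// ge0_fin_numE.
Qed.

End ProductSigmaFinite.

Section TuplePower.
Context d (T : measurableType d) (R : realType).
Variable mu : {sigma_finite_measure set T -> \bar R}.

Definition tcons n (z : T * n.-tuple T) : n.+1.-tuple T := [tuple of z.1 :: z.2].

Lemma measurable_tcons n : measurable_fun setT (@tcons n).
Proof. by apply: measurable_cons => //. Qed.

Section step.
Variables (n : nat) (nu : {sigma_finite_measure set (n.-tuple T) -> \bar R}).

Definition cons_measure : set (n.+1.-tuple T) -> \bar R :=
  pushforward (mu \x nu)%E (@tcons n).

HB.instance Definition _ := Measure.copy cons_measure
  (measure_function_pushforward__canonical__measure_function_Measure
     (mu \x nu)%E (@measurable_tcons n)).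

Let uncons (t : n.+1.-tuple T) : T * n.-tuple T :=
  (thead t, [tuple of behead t]).

Let measurable_uncons : measurable_fun setT uncons.
Proof.
apply/measurable_fun_pairP; split; first exact: measurable_tnth.
exact: measurable_behead.
Qed.

Let tconsK : cancel (@tcons n) uncons.
Proof.
by case=> a t; rewrite /uncons theadE; congr pair; exact: val_inj.
Qed.

Lemma cons_measure_sigma_finite : sigma_finite setT cons_measure.
Proof.
have [F FT Foo] := product_sigma_finite mu nu.
exists (fun i => uncons @^-1` F i).
  by rewrite -preimage_bigcup -FT preimage_setT.
move=> i; have [mF Fioo] := Foo i; split.
  by rewrite -[X in measurable X]setTI; exact: measurable_uncons.
rewrite /cons_measure /pushforward /=.
rewrite (_ : _ @^-1` _ = F i)//.
by apply/seteqP; split=> z /=; rewrite tconsK.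
Qed.

HB.instance Definition _ := Measure_isSigmaFinite.Build _ _ _ cons_measure
  cons_measure_sigma_finite.

End step.

Fixpoint power_measure n : {sigma_finite_measure set (n.-tuple T) -> \bar R} :=
  match n with
  | 0 => \d_([tuple] : 0.-tuple T)
  | n'.+1 => cons_measure (power_measure n')
  end.

Lemma power_measure_box n (A : 'I_n -> set T) : (forall i, measurable (A i)) ->
  power_measure n [set t | forall i, A i (tnth t i)] = (\prod_i mu (A i))%E.
Proof.
elim: n A => [|n ih] A mA.
  by rewrite big_ord0 /= diracE mem_set// => -[].
pose B := [set t : n.-tuple T | forall i, A (lift ord0 i) (tnth t i)].
have mB : measurable B.
  rewrite [B](_ : _ = \bigcap_(i in [set: 'I_n])
    ((@tnth n T)^~ i @^-1` A (lift ord0 i))); last first.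
    by apply/seteqP; split=> t /= tA i => [_|]; exact: tA.
  apply: fin_bigcap_measurable => // i _.
  rewrite -[X in measurable X]setTI; apply: measurable_tnth => //.
rewrite big_ord_recl -ih// -product_measure1E//.
rewrite /= /cons_measure /pushforward; congr (product_measure1 _ _ _).
apply/seteqP; split=> -[a t] /= tA.
  split=> [|i]; first by have := tA ord0; rewrite tnth0.
  by have := tA (lift ord0 i); rewrite tnthS.
move=> i; case: (unliftP ord0 i) => [j ->|->]; first by rewrite tnthS; exact: tA.2.
by rewrite tnth0; exact: tA.1.
Qed.

End TuplePower.

Section ComplexIntegral.
Context d (T : measurableType d) (R : realType).
Variable mu : {measure set T -> \bar R}.

Definition cintegrable (f : T -> R[i]) : Prop :=
  mu.-integrable setT (fun t => (complex.Re (f t))%:E) /\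
  mu.-integrable setT (fun t => (complex.Im (f t))%:E).

(* Rintegral is 0 on a non-integrable function, so this value is meaningful *)
(* only together with cintegrable.                                          *)
Definition cintegral (f : T -> R[i]) : R[i] :=
  (\int[mu]_t complex.Re (f t))%R +i* (\int[mu]_t complex.Im (f t))%R.

End ComplexIntegral.

Section LebesgueComplex.
Context {R : realType}.

(* C is identified with R * R, (a, b) standing for a + bi; measurableTypeR  *)
(* R is R with its Borel sets, on which lebesgue_measure is defined.        *)
Local Notation R2 := (measurableTypeR R * measurableTypeR R)%type.

Definition tocomplex (z : R2) : R[i] := z.1 +i* z.2.

Definition lebesgue_complex : set R2 -> \bar R :=
  (@lebesgue_measure R \x @lebesgue_measure R)%E.

HB.instance Definition _ := Measure.on lebesgue_complex.
HB.instance Definition _ := Measure_isSigmaFinite.Build _ _ _ lebesgue_complex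
  (product_sigma_finite (@lebesgue_measure R) (@lebesgue_measure R)).

Definition lebesgue_Cqp (p q : nat) :
    {sigma_finite_measure set (p.-tuple (q.-tuple R2)) -> \bar R} :=
  power_measure (power_measure lebesgue_complex q) p.

End LebesgueComplex.

Section Wirtinger.
Context {R : realType} {m : nat}.
Implicit Types (f : 'rV[R[i]]_m -> R[i]) (u v : 'rV[R[i]]_m) (j : 'I_m).

(* Derivative along the real line u + R v; 'D_v is not usable here, since   *)
(* the scalars of 'rV[R[i]]_m are complex.                                  *)
Definition real_derive v f u : R[i] :=
  derive1 (fun t : R => complex.Re (f (u + t%:C *: v))) 0 +i*
  derive1 (fun t : R => complex.Im (f (u + t%:C *: v))) 0.

Definition partial_re j f := real_derive (delta_mx 0 j) f.
Definition partial_im j f := real_derive ('i%C *: delta_mx 0 j) f.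

Definition partial_z j f u : R[i] :=
  (partial_re j f u - 'i%C * partial_im j f u) / 2.
Definition partial_zbar j f u : R[i] :=
  (partial_re j f u + 'i%C * partial_im j f u) / 2.

Lemma real_derive0 v : real_derive v (fun=> 0) = fun=> 0.
Proof. by apply/funext => u; rewrite /real_derive /= !derive1_cst. Qed.

End Wirtinger.

Section KudlaMillson.
Context (R : realType) (p q : nat).

Local Notation C := R[i].
Local Notation U := 'rV[R[i]]_(p + q).

(* inl (j, k) is xi_jk and inr (j, k) is its conjugate. *)
Local Notation gens := ('I_p * 'I_q + 'I_p * 'I_q)%type.
Local Notation Lam := (extalg R[i] gens).

Definition hform (u v : U) : C :=
  \sum_(i < p) u 0 (lshift q i) * (v 0 (lshift q i))^*%C -
  \sum_(i < q) u 0 (rshift p i) * (v 0 (rshift p i))^*%C.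

Definition xi (j : 'I_p) (k : 'I_q) : Lam := ext_gen (inl (j, k)).
Definition xibar (j : 'I_p) (k : 'I_q) : Lam := ext_gen (inr (j, k)).

Definition gauss (u : U) : C :=
  (expR (- pi * \sum_(i < p + q)
    (complex.Re (u 0 i) ^+ 2 + complex.Im (u 0 i) ^+ 2)))%:C.

(* conj z_j - (1/pi) d/dz_j and z_j - (1/pi) d/d(conj z_j), with j <= p.    *)
Definition raise (j : 'I_p) (f : U -> C) (u : U) : C :=
  (u 0 (lshift q j))^*%C * f u - (pi^-1)%:C * partial_z (lshift q j) f u.
Definition raisebar (j : 'I_p) (f : U -> C) (u : U) : C :=
  u 0 (lshift q j) * f u - (pi^-1)%:C * partial_zbar (lshift q j) f u.

(* The operator x (x) P on Lambda-valued functions: P acts on coordinates,  *)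
(* followed by left multiplication by x.                                    *)
Definition ext_op (x : Lam) (P : (U -> C) -> (U -> C)) (f : U -> Lam)
    (u : U) : Lam :=
  wedge x [ffun A : {set gens} => P (fun v => f v A) u].

(* Composition of operators, A_1 (A_2 (... (A_q f))). *)
Definition Dplus (f : U -> Lam) (u : U) : Lam :=
  2 ^- (2 * q) *:
  (\big[(fun F G => F \o G)/idfun]_(k < q)
     (fun (g : U -> Lam) v => \sum_(j < p) ext_op (xi j k) (raise j) g v)) f u.
Definition Dplusbar (f : U -> Lam) (u : U) : Lam :=
  2 ^- (2 * q) *:
  (\big[(fun F G => F \o G)/idfun]_(k < q)
     (fun (g : U -> Lam) v =>
        \sum_(j < p) ext_op (xibar j k) (raisebar j) g v)) f u.

Definition phi_qq : U -> Lam :=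
  Dplus (Dplusbar (fun u => gauss u *: ext_one)).

Definition phi_pqpq (u : 'I_p -> U) : Lam :=
  \big[wedge/ext_one]_(j < p) phi_qq (u j).

Definition omega : Lam :=
  \big[wedge/ext_one]_(k < q) \big[wedge/ext_one]_(j < p) xi j k.
Definition omegabar : Lam :=
  \big[wedge/ext_one]_(k < q) \big[wedge/ext_one]_(j < p) xibar j k.

(* Quotient of the top-degree coordinates; phiKME shows that this is the    *)
(* function defined by phi_pqpq = (omega omegabar) phiKM.                   *)
Definition phiKM (u : 'I_p -> U) : C :=
  phi_pqpq u finset.setT / wedge omega omegabar finset.setT.

Lemma raise0 j : raise j (fun=> 0) = fun=> 0.
Proof.
apply/funext => u; rewrite /raise /partial_z /partial_re /partial_im.
by rewrite !real_derive0 !mulr0 subr0 mul0r mulr0 subr0.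
Qed.

Lemma raisebar0 j : raisebar j (fun=> 0) = fun=> 0.
Proof.
apply/funext => u; rewrite /raisebar /partial_zbar /partial_re /partial_im.
by rewrite !real_derive0 !mulr0 addr0 mul0r mulr0 subr0.
Qed.

Lemma ext_homog_op n i P (f : U -> Lam) :
  P (fun=> 0) = (fun=> 0) -> (forall u, ext_homog n (f u)) ->
  forall u, ext_homog n.+1 (ext_op (ext_gen i) P f u).
Proof.
move=> P0 hf u; rewrite -add1n; apply: ext_homog_wedge.
  by rewrite -(cards1 i); exact: ext_homog_basis.
move=> A cA; rewrite ffunE (_ : (fun v => f v A) = fun=> 0) ?P0//.
by apply/funext => v; exact: hf.
Qed.

Lemma ext_homog_comp n (A : 'I_q -> (U -> Lam) -> U -> Lam) (f : U -> Lam) :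
  (forall m k g, (forall u, ext_homog m (g u)) ->
    forall u, ext_homog m.+1 (A k g u)) ->
  (forall u, ext_homog n (f u)) ->
  forall u, ext_homog (q + n)%N
    ((\big[(fun F G => F \o G)/idfun]_(k < q) A k) f u).
Proof.
move=> hA hf; have -> : (q + n = size (index_enum 'I_q) + n)%N.
  by rewrite [index_enum _]unlock -enumT size_enum_ord.
elim: (index_enum 'I_q) => [|k r ih] u; first by rewrite big_nil add0n; exact: hf.
by rewrite big_cons /= addSn; apply: hA.
Qed.

Lemma phi_qq_homog u : ext_homog (q + q)%N (phi_qq u).
Proof.
apply: ext_homogZ; apply: ext_homog_comp u => [m k g hg u|u].
  by apply: ext_homog_sum => j; apply: ext_homog_op => //; exact: raise0.
apply: ext_homogZ; rewrite -[X in ext_homog X]addn0; apply: ext_homog_comp u.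
  move=> m k g hg u; apply: ext_homog_sum => j.
  by apply: ext_homog_op => //; exact: raisebar0.
by move=> u; apply: ext_homogZ; exact: ext_homog_one.
Qed.

Lemma phi_pqpq_homog u : ext_homog #|{: gens}| (phi_pqpq u).
Proof.
have -> : #|{: gens}| = (size (index_enum 'I_p) * (q + q))%N.
  rewrite [index_enum _]unlock -enumT size_enum_ord.
  by rewrite card_sum card_prod !card_ord mulnDr.
rewrite /phi_pqpq.
elim: (index_enum 'I_p) => [|k r ih].
  by rewrite big_nil; exact: ext_homog_one.
by rewrite big_cons mulSn; apply: ext_homog_wedge => //; exact: phi_qq_homog.
Qed.

Lemma omega_basis : signed_basis finset.setT (wedge omega omegabar).
Proof.
pose S (g : 'I_p -> 'I_q -> gens) k := (\bigcup_j [set g j k])%SET.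
have sS (g : 'I_p -> 'I_q -> gens) :
    (forall j k j' k', g j k = g j' k' -> j = j' /\ k = k') ->
  signed_basis (\bigcup_k S g k)%SET
    (\big[wedge/ext_one]_(k < q) \big[wedge/ext_one]_(j < p)
       (ext_gen (g j k) : Lam)).
  move=> gI; apply: signed_basis_big => [k k' kk'|k].
    rewrite finset.disjoints_subset; apply/fintype.subsetP => i.
    move=> /finset.bigcupP[j _ /finset.set1P ->]; rewrite inE.
    apply/negP => /finset.bigcupP[j' _ /finset.set1P /gI[_ /eqP]].
    exact/negP.
  apply: signed_basis_big => [j j' jj'|j]; last first.
    by exists 0%N; rewrite expr0 scale1r.
  rewrite finset.disjoints_subset; apply/fintype.subsetP => i /finset.set1P ->.
  by rewrite !inE; apply: contra jj' => /eqP /gI[-> _].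
rewrite (_ : finset.setT = (\bigcup_k S (fun j k => inl (j, k)) k) :|:
    (\bigcup_k S (fun j k => inr (j, k)) k))%SET.
  apply: signed_basis_wedge; [|by apply: sS => ? ? ? ? [-> ->]..].
  rewrite finset.disjoints_subset; apply/fintype.subsetP => i.
  move=> /finset.bigcupP[k _ /finset.bigcupP[j _ /finset.set1P ->]].
  rewrite inE; apply/negP.
  by move=> /finset.bigcupP[k' _ /finset.bigcupP[j' _ /finset.set1P]].
apply/esym/eqP; rewrite -finset.subTset; apply/fintype.subsetP => i _.
by rewrite inE; case: i => -[j k]; apply/orP; [left|right];
  apply/finset.bigcupP; exists k => //; apply/finset.bigcupP; exists j => //;
  rewrite inE.
Qed.

Lemma phiKME u : phi_pqpq u = phiKM u *: wedge omega omegabar.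
Proof.
have [n oE] := omega_basis; apply/ffunP => A.
rewrite /phiKM oE !ffunE !eqxx.
have [->|AT] := eqVneq A finset.setT.
  have s0 : (-1) ^+ n != 0 :> C by rewrite signr_eq0.
  by rewrite /GRing.scale/= !mulr1 divfK.
rewrite !scaler0 phi_pqpq_homog//; apply: contra AT => /eqP cA.
by rewrite finset.eqEcard finset.subsetT finset.cardsT cA /=.
Qed.

(* e_k = (u_k + u_(m+1-k)) / sqrt 2; rev_ord is i |-> m-1-i on 0-based      *)
(* indices.                                                                 *)
Definition evec (k : 'I_q) : U :=
  let k' := widen_ord (leq_addl p q) k in
  ((Num.sqrt 2)^-1)%:C *: (delta_mx 0 k' + delta_mx 0 (rev_ord k')).

Lemma evec_lshift k (i : 'I_p) : (q < p)%N ->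
  evec k 0 (lshift q i) = ((Num.sqrt 2)^-1)%:C * (val i == val k)%:R.
Proof.
move=> qp; rewrite !mxE /= -!val_eqE /= [X in _ + X](_ : _ = 0) ?addr0//.
rewrite (_ : _ == _ = false)//; apply/negbTE; rewrite neq_ltn.
by rewrite (leq_trans (ltn_ord i))// -addnBA ?leq_addr.
Qed.

Lemma evec_rshift k (i : 'I_q) : (q < p)%N ->
  evec k 0 (rshift p i) = ((Num.sqrt 2)^-1)%:C * (i == rev_ord k)%:R.
Proof.
move=> qp; rewrite !mxE /= -!val_eqE /= [X in X + _](_ : _ = 0) ?add0r.
  by rewrite -addnBA// eqn_add2l.
rewrite (_ : _ == _ = false)//; apply/negbTE; rewrite neq_ltn orbC.
by rewrite (leq_trans (ltn_ord k))// (leq_trans (ltnW qp))// leq_addr.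
Qed.

Lemma evec_isotropic k l : (q < p)%N -> hform (evec k) (evec l) = 0.
Proof.
move=> qp; rewrite /hform (bigD1 (widen_ord (ltnW qp) k)) //=.
rewrite [X in _ + X - _]big1 => [|i ik]; last first.
  by rewrite evec_lshift// (_ : _ == _ = false) ?mulr0 ?mul0r//; apply/negbTE.
rewrite (bigD1 (rev_ord k)) //= [X in _ - (_ + X)]big1 => [|i ik]; last first.
  by rewrite evec_rshift// (negbTE ik) mulr0 mul0r.
by rewrite !evec_lshift// !evec_rshift// !eqxx !(inj_eq rev_ord_inj) subrr.
Qed.

(* Span of u_(q+1), ..., u_p, the index i being 0-based. *)
Definition Uprime : {vspace U} :=
  span [seq (delta_mx 0 i : U) | i : 'I_(p + q) <- enum 'I_(p + q)
         & (q <= i < p)%N].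

(* The function of y in (C^q)^p whose integral is the Ikeda map at x. *)
Definition ikeda_integrand (Psi : ('I_p -> U) -> C) (x : 'I_p -> U)
    (y : p.-tuple (q.-tuple (measurableTypeR R * measurableTypeR R))) : C :=
  Psi (fun j => \sum_(k < q) tocomplex (tnth (tnth y j) k) *: evec k + x j).

End KudlaMillson.

(* Main.v *)
(* Write u = sum_k y_k e_k + x. In the directions of the y_k the Gaussian has *)
(* total weight exp(- pi |y_k|^2), half of it from z_k and half from          *)
(* z_(m+1-k), so the operator conj z_k - (1/pi) d/dz_k, applied to a          *)
(* polynomial in z_1, ..., z_p times the Gaussian and restricted to such u,   *)
(* is a total derivative in y_k and integrates to 0. A coefficient of         *)
(* phi_qq on a basis vector containing xi_11 is of this form, so it has       *)
(* integral 0. By Fubini, the integral of the top coefficient of              *)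
(* phi_qq(u^(1)) ^ ... ^ phi_qq(u^(p)) is a sum of products of integrals of   *)
(* coefficients, one of which contains xi_11 in each product.                 *)

Require Import Defs.
From mathcomp Require Import all_boot all_order all_algebra.
From mathcomp Require Import complex.
From mathcomp Require Import all_classical all_reals all_analysis.
From mathcomp Require Import measurable_realfun ring lra.

Set Implicit Arguments.
Unset Strict Implicit.
Unset Printing Implicit Defensive.
Import Order.TTheory GRing.Theory Num.Theory.
Import numFieldNormedType.Exports.
Local Open Scope ring_scope.
Local Open Scope classical_set_scope.
Local Open Scope complex_scope.

(** At a point u = sum_k y_k e_k + x the coordinates z_k and z_(m+1-k) both equal y_k / sqrt 2, and
    their Gaussian factors merge into exp(- pi |y_k|^2). The raising operators involve only z_1,
    ..., z_p, so every coefficient of [phi_qq] is a polynomial in the real and imaginary parts of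
    these coordinates times the Gaussian ([hspan_phi_qq]), and the integral of each monomial is a
    product of one-variable moments ([has_cint_hmono]).

    Raising in a real coordinate s of z_k, k <= q, turns s^n into 2 s^(n+1) - n/(2 pi) s^(n-1) in
    front of the Gaussian. Integration by parts ([gmomentS]) relates the two moments, and with the
    scaling 1 / sqrt 2 they cancel exactly ([iweight_ladder], [has_cint_ladder]). Hence every
    coefficient of [phi_qq] that contains xi_11 has integral 0 ([has_cint_phi_qq0]).

    In the top coefficient of the wedge over the p vectors, each term has exactly one factor whose
    index set contains xi_11; Fubini ([has_cint_big_wedge]) makes the term vanish. Dividing by the
    constant top coefficient of omega omegabar gives the result for [phiKM]. Integrability is
    carried along with the value of each integral. *)

(** * Fubini for products of complex functions *)

Section HasIntegral.
Context {d} {T : measurableType d} {R : realType}.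
Variable mu : {measure set T -> \bar R}.
Implicit Types (f g : T -> R) (h k : T -> R[i]).

(** Integrability and value are bundled because [Rintegral] has a default value on non-integrable
    functions; linearity and Fubini then transport both at once. *)
Definition has_int f (I : R) : Prop :=
  mu.-integrable setT (EFin \o f) /\ \int[mu]_t f t = I.

Lemma has_intD f g I J : has_int f I -> has_int g J ->
  has_int (fun t => f t + g t) (I + J).
Proof.
move=> [fi <-] [gi <-]; split; last exact: RintegralD.
by rewrite (_ : _ \o _ = (EFin \o f) \+ (EFin \o g))%E//; exact: integrableD.
Qed.

Lemma has_intZ f I c : has_int f I -> has_int (fun t => c * f t) (c * I).
Proof.
move=> [fi <-]; split; last exact: RintegralZl.
by rewrite (_ : _ \o _ = (fun t => c%:E * (EFin \o f) t)%E)//; exact: integrableZl.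
Qed.

Lemma has_intB f g I J : has_int f I -> has_int g J ->
  has_int (fun t => f t - g t) (I - J).
Proof.
move=> fI /(has_intZ (-1)) /(has_intD fI); rewrite mulN1r.
by under eq_fun do rewrite mulN1r.
Qed.

Definition has_cint h (I : R[i]) : Prop :=
  cintegrable mu h /\ cintegral mu h = I.

Lemma has_cintP h I : has_cint h I <->
  has_int (fun t => complex.Re (h t)) (complex.Re I) /\
  has_int (fun t => complex.Im (h t)) (complex.Im I).
Proof.
split=> [[[? ?] <-]//|[[? hR] [? hI]]]; split=> //.
by rewrite /cintegral hR hI; case: I {hR hI}.
Qed.

Lemma has_cintD h k I J : has_cint h I -> has_cint k J ->
  has_cint (fun t => h t + k t) (I + J).
Proof.
move=> /has_cintP[hR hI] /has_cintP[kR kI]; apply/has_cintP; rewrite !raddfD/=.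
by split; under eq_fun do rewrite raddfD; exact: has_intD.
Qed.

Lemma complex_ReM (x y : R[i]) : complex.Re (x * y) =
  complex.Re x * complex.Re y - complex.Im x * complex.Im y.
Proof. by case: x y => [a b] [c e]. Qed.

Lemma complex_ImM (x y : R[i]) : complex.Im (x * y) =
  complex.Re x * complex.Im y + complex.Im x * complex.Re y.
Proof. by case: x y => [a b] [c e]. Qed.

Lemma has_cintZ h I c : has_cint h I -> has_cint (fun t => c * h t) (c * I).
Proof.
move=> /has_cintP[hR hI]; apply/has_cintP; rewrite complex_ReM complex_ImM.
split; [under eq_fun do rewrite complex_ReM|under eq_fun do rewrite complex_ImM].
  by apply: has_intB; exact: has_intZ.
by apply: has_intD; exact: has_intZ.
Qed.

Lemma has_cint_real f I : has_int f I -> has_cint (fun t => (f t)%:C) I%:C.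
Proof.
move=> fI; apply/has_cintP; split => //=; split; first exact: integrable0.
by rewrite /Rintegral integral0.
Qed.

Lemma has_cint0 : has_cint (fun=> 0) 0.
Proof.
apply: has_cint_real; split; first exact: integrable0.
by rewrite /Rintegral integral0.
Qed.

Lemma has_cint_sum (I : Type) (r : seq I) (P : pred I) (F : I -> T -> R[i]) V :
  (forall i, P i -> has_cint (F i) (V i)) ->
  has_cint (fun t => \sum_(i <- r | P i) F i t) (\sum_(i <- r | P i) V i).
Proof.
move=> FV; elim: r => [|i r ih].
  by rewrite big_nil; under eq_fun do rewrite big_nil; exact: has_cint0.
rewrite big_cons; under eq_fun do rewrite big_cons.
by case: ifPn => // Pi; apply: has_cintD => //; exact: FV.
Qed.

Lemma has_cintZ0 h c : has_cint h 0 -> has_cint (fun t => c * h t) 0.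
Proof. by move=> /(has_cintZ c); rewrite mulr0. Qed.

Lemma has_cint_sum0 (I : Type) (r : seq I) (P : pred I) (F : I -> T -> R[i]) :
  (forall i, P i -> has_cint (F i) 0) ->
  has_cint (fun t => \sum_(i <- r | P i) F i t) 0.
Proof. by move=> /(has_cint_sum r); rewrite big1. Qed.

End HasIntegral.

Section HasIntegralProduct.
Context {d1 d2} {T1 : measurableType d1} {T2 : measurableType d2} {R : realType}.
Variables (m1 : {sigma_finite_measure set T1 -> \bar R})
          (m2 : {sigma_finite_measure set T2 -> \bar R}).

(** By Tonelli, integrability reduces to finiteness of the product of the integrals of |f| and |g|;
    Fubini then gives the value. *)
Lemma has_int_prod (f : T1 -> R) (g : T2 -> R) I J :
  has_int m1 f I -> has_int m2 g J ->
  has_int (m1 \x m2)%E (fun z => f z.1 * g z.2) (I * J).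
Proof.
move=> [fi <-] [gi <-].
pose fg (z : T1 * T2) := f z.1 * g z.2.
have mfg : measurable_fun setT fg.
  apply: measurable_funM.
    by apply: measurableT_comp => //; apply/measurable_EFinP; exact: measurable_int fi.
  by apply: measurableT_comp => //; apply/measurable_EFinP; exact: measurable_int gi.
have fgi : (m1 \x m2)%E.-integrable setT (EFin \o fg).
  apply/integrable12ltyP; first exact/measurable_EFinP.
  have gN : m2.-integrable setT (fun y => `|(g y)%:E|%E) by exact: integrable_abse gi.
  have E x : (\int[m2]_y `|(EFin \o fg) (x, y)| =
      `|f x|%:E * \int[m2]_y `|(g y)%:E|)%E.
    rewrite -integralZl//; apply: eq_integral => y _.
    by rewrite /fg/= normrM EFinM.
  under eq_integral do rewrite E.
  have gfin : (\int[m2]_y `|(g y)%:E| \is a fin_num)%E by exact: integrable_fin_num.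
  have fN : m1.-integrable setT (fun x => `|f x|%:E) by exact: integrable_abse fi.
  rewrite -(fineK gfin) integralZr// fineK// ltey_eq fin_numM//.
  exact: integrable_fin_num.
split=> //; rewrite /Rintegral -(integral12_prod_meas1 fgi) /fubini_F/=.
have gfin : (\int[m2]_y (g y)%:E \is a fin_num)%E by exact: (integrable_fin_num measurableT gi).
have E x : (\int[m2]_y (fg (x, y))%:E = (f x)%:E * \int[m2]_y (g y)%:E)%E.
  by rewrite -integralZl.
under eq_integral do rewrite E.
rewrite -(fineK gfin) integralZr// fineM//; last exact: (integrable_fin_num measurableT fi).
Qed.

End HasIntegralProduct.

Section HasIntegralPower.
Context {d} {T : measurableType d} {R : realType}.
Variable mu : {sigma_finite_measure set T -> \bar R}.

(** The power measure is the image of a product measure under [tcons], so a change of variables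
    reduces this to [has_int_prod]. *)
Lemma has_int_cons n (f : T -> R) (g : n.-tuple T -> R) I J :
  has_int mu f I -> has_int (power_measure mu n) g J ->
  has_int (power_measure mu n.+1)
    (fun t => f (thead t) * g [tuple of behead t]) (I * J).
Proof.
move=> fI gJ; have [hi hIJ] := has_int_prod fI gJ.
pose h (t : n.+1.-tuple T) := f (thead t) * g [tuple of behead t].
have hE : h \o @tcons _ T n = fun z => f z.1 * g z.2.
  apply/funext => -[a t]; rewrite /h /= theadE; congr (_ * g _).
  exact: val_inj.
have mf : measurable_fun setT f by case: fI => /measurable_int/measurable_EFinP.
have mg : measurable_fun setT g by case: gJ => /measurable_int/measurable_EFinP.
have mh : measurable_fun setT (EFin \o h).
  apply/measurable_EFinP/measurable_funM.
    by apply: measurableT_comp => //; exact: measurable_tnth.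
  by apply: measurableT_comp => //; exact: measurable_behead.
have hi' : (mu \x power_measure mu n)%E.-integrable (@tcons _ T n @^-1` setT)
    ((EFin \o h) \o @tcons _ T n).
  by rewrite preimage_setT -compA hE.
have mt := measurable_tcons (T := T) (n := n).
split; first exact: (integrable_pushforward mt mh hi' measurableT).
rewrite -hIJ /Rintegral -/(h _); congr fine.
rewrite [LHS](integral_pushforward mt mh hi' measurableT).
by rewrite preimage_setT -compA hE.
Qed.

Lemma has_cint_cons n (f : T -> R[i]) (g : n.-tuple T -> R[i]) I J :
  has_cint mu f I -> has_cint (power_measure mu n) g J ->
  has_cint (power_measure mu n.+1)
    (fun t => f (thead t) * g [tuple of behead t]) (I * J).
Proof.
move=> /has_cintP[fR fI] /has_cintP[gR gI]; apply/has_cintP.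
rewrite complex_ReM complex_ImM.
split; [under eq_fun do rewrite complex_ReM|under eq_fun do rewrite complex_ImM].
  by apply: has_intB; [exact: (has_int_cons fR gR)|exact: (has_int_cons fI gI)].
by apply: has_intD; [exact: (has_int_cons fR gI)|exact: (has_int_cons fI gR)].
Qed.

Lemma has_cint_power0 (f : 0.-tuple T -> R[i]) :
  has_cint (power_measure mu 0) f (f [tuple]).
Proof.
have H (h : 0.-tuple T -> R) : has_int (power_measure mu 0) h (h [tuple]).
  have -> : h = cst (h [tuple]) by apply/funext => t; rewrite (tuple0 t).
  split; first by apply: finite_measure_integrable_cst.
  rewrite Rintegral_cst//.
  rewrite -[RHS]mulr1; congr (_ * _).
  exact: (congr1 fine (diracT R _)).
by apply/has_cintP.
Qed.

Lemma tnth_behead_tuple n (t : n.+1.-tuple T) i :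
  tnth [tuple of behead t] i = tnth t (lift ord0 i).
Proof. by rewrite [in RHS](tuple_eta t) tnthS. Qed.

Lemma has_cint_big_prod n (f : 'I_n -> T -> R[i]) (I : 'I_n -> R[i]) :
  (forall i, has_cint mu (f i) (I i)) ->
  has_cint (power_measure mu n) (fun t => \prod_(i < n) f i (tnth t i))
    (\prod_(i < n) I i).
Proof.
elim: n f I => [|n ih] f I fI.
  under eq_fun do rewrite big_ord0; rewrite big_ord0.
  exact: (has_cint_power0 (fun=> 1)).
under eq_fun do rewrite big_ord_recl; rewrite big_ord_recl.
under eq_fun => t do under eq_bigr do rewrite -tnth_behead_tuple.
exact: (has_cint_cons (fI ord0) (ih _ _ (fun i => fI (lift ord0 i)))).
Qed.

End HasIntegralPower.

(** * Gaussian moments *)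

Section PointwiseDerivatives.
Context {R : realType}.
Implicit Types (f g : R -> R) (x a b : R).

Lemma is_derive_addf f g x a b : is_derive x 1 f a -> is_derive x 1 g b ->
  is_derive x 1 (fun t => f t + g t) (a + b).
Proof. by move=> fa gb; exact: is_deriveD. Qed.

Lemma is_derive_mulf f g x a b : is_derive x 1 f a -> is_derive x 1 g b ->
  is_derive x 1 (fun t => f t * g t) (a * g x + f x * b).
Proof.
move=> fa gb; apply: is_derive_eq (is_deriveM fa gb) _.
by rewrite addrC /GRing.scale/= [g x * a]mulrC.
Qed.

Lemma is_derive_cmulf c f x a : is_derive x 1 f a ->
  is_derive x 1 (fun t => c * f t) (c * a).
Proof. by move=> fa; exact: is_deriveZ. Qed.

Lemma is_derive_expf f n x a : is_derive x 1 f a ->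
  is_derive x 1 (fun t => f t ^+ n) (n%:R * f x ^+ n.-1 * a).
Proof. by move=> fa; rewrite -exprfctE; exact: is_deriveX. Qed.

Lemma is_derive_expRf f x a : is_derive x 1 f a ->
  is_derive x 1 (fun t => expR (f t)) (expR (f x) * a).
Proof. by move=> fa; exact: is_derive1_comp. Qed.

End PointwiseDerivatives.

Section GaussianMoments.
Context {R : realType}.
Local Notation mu := (@lebesgue_measure R).
Implicit Types (F f : R -> R) (s : R).

(** The integral over [-(n+1), n+1] is a difference of values of F, which tends to 0; dominated
    convergence with bound |f| identifies its limit with the full integral. *)
Lemma has_int_derive0 F f : (forall s, is_derive s 1 F (f s)) ->
  continuous f -> mu.-integrable setT (EFin \o f) ->
  F n%:R @[n --> \oo] --> (0 : R) -> F (- n%:R) @[n --> \oo] --> (0 : R) ->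
  has_int mu f 0.
Proof.
move=> dF cf fi F0 FN0; split=> //.
(* The bound [n.+1] keeps the interval nondegenerate at n = 0, as the fundamental theorem of
   calculus demands. *)
pose I n := `[- n.+1%:R, n.+1%:R]%classic : set R.
have mI n : measurable (I n) by exact: measurable_itv.
pose f_ n := (EFin \o f) \_ (I n).
have mf : measurable_fun setT (EFin \o f) by exact: measurable_int fi.
have f_f : (\int[mu]_x f_ n x @[n --> \oo] --> \int[mu]_x (f x)%:E)%E.
  apply: (@dominated_cvg _ _ _ mu setT measurableT f_ _ (abse \o (EFin \o f))).
  - by move=> n; apply/(measurable_restrictT _ (mI n)); exact: measurable_funTS.
  - move=> x _; apply: cvg_near_cst; near=> n.
    rewrite /f_ patchE mem_set// /I /= in_itv/= -ler_norml.
    near: n; apply: filterS (nbhs_infty_ger `|x|) => n /le_trans; apply.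
    by rewrite ler_nat.
  - by move=> x _.
  - exact: integrable_abse.
  - move=> n x _; rewrite /f_ patchE; case: ifPn => //= _.
    by rewrite normr0 lee_fin.
have FTC n : (\int[mu]_x f_ n x = (F n.+1%:R)%:E - (F (- n.+1%:R))%:E)%E.
  rewrite -integral_mkcond; apply: continuous_FTC2.
  - by rewrite gtrN// ltr0n.
  - exact: continuous_subspaceT.
  - have cF : continuous F.
      by move=> x; apply/differentiable_continuous/derivable1_diffP; case: (dF x).
    split; first by move=> x _; case: (dF x).
      by apply: cvg_at_right_filter; exact: cF.
    by apply: cvg_at_left_filter; exact: cF.
  - by move=> x _; rewrite derive1E derive_val.
have lim0 : (\int[mu]_x f_ n x @[n --> \oo] --> 0%E)%E.
  under eq_cvg do rewrite FTC -EFinB.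
  apply: cvg_EFin; first exact: nearW.
  rewrite -[X in _ --> X](subr0 0); apply: cvgB.
    by rewrite (cvg_shiftS (fun n => F n%:R)).
  by rewrite (cvg_shiftS (fun n => F (- n%:R))).
by rewrite /Rintegral -(cvg_lim _ f_f)// (cvg_lim _ lim0).
Unshelve. all: by end_near. Qed.

Definition gmom n s : R := s ^+ n * expR (- pi * s ^+ 2).

(** For n = 0 the default [0.-1 = 0] is harmless, its coefficient being 0. *)
Lemma is_derive_gmom n s :
  is_derive s 1 (gmom n) (n%:R * gmom n.-1 s - 2 * pi * gmom n.+1 s).
Proof.
have d : is_derive s 1 (id : R -> R) 1 by exact: is_derive_id.
apply: is_derive_eq; first exact: (is_derive_mulf (is_derive_expf n d)
  (is_derive_expRf (is_derive_cmulf (- pi) (is_derive_expf 2 d)))).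
rewrite /gmom /=; move: (expR _) => E; case: n => [|n] /=; rewrite ?exprS; ring.
Qed.

(** One has |s|^n <= 1 + s^(2(n+1)) <= (n+1)! exp(s^2) by the exponential series, and s^2 - pi s^2
    <= - s^2 since pi >= 2. *)
Lemma norm_gmom_le n s : `|gmom n s| <= (n.+1)`!%:R * gauss_fun s.
Proof.
rewrite normrM (ger0_norm (expR_ge0 _)) normrX.
have H : `|s| ^+ n <= (n.+1)`!%:R * expR (s ^+ 2).
  apply: (@le_trans _ _ (1 + (s ^+ 2) ^+ n.+1)).
    rewrite -real_normK ?num_real// -exprM; have [s1|s1] := leP `|s| 1.
      by rewrite (le_trans (exprn_ile1 _ (normr_ge0 s) s1))// lerDl exprn_ge0.
    by rewrite ler_wpDl// ler_eXn2l// mul2n -addnn leqW// leq_addr.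
  have f1 : 1 <= (n.+1)`!%:R :> R by rewrite ler1n fact_gt0.
  have f0 : 0 < (n.+1)`!%:R :> R by rewrite ltr0n fact_gt0.
  have B := expR_ge1Dxn n (sqr_ge0 s).
  apply: le_trans _ (ler_wpM2l (ltW f0) B).
  by rewrite mulrDr mulr1 mulrCA divff ?mulr1 ?gt_eqF// lerD2r.
apply: le_trans (ler_wpM2r (expR_ge0 _) H) _.
rewrite -mulrA ler_wpM2l// /gauss_fun -expRD ler_expR.
have := @pi_ge2 R; have := sqr_ge0 s; nra.
Qed.

Lemma continuous_gmom n : continuous (gmom n).
Proof.
move=> s; apply/differentiable_continuous/derivable1_diffP.
by have := is_derive_gmom n s; case.
Qed.

Lemma integrable_gmom n : mu.-integrable setT (EFin \o gmom n).
Proof.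
have := integrableZl measurableT ((n.+1)`!%:R) (@integrableT_gauss R).
apply: le_integrable => //.
  apply/measurable_EFinP; apply: continuous_measurable_fun.
  exact: continuous_gmom.
move=> s _ /=; rewrite lee_fin (le_trans (norm_gmom_le _ _))//.
by rewrite ler_norm.
Qed.

Lemma gmomN n s : gmom n (- s) = (-1) ^+ n * gmom n s.
Proof. by rewrite /gmom sqrrN (exprNn s) -mulrA. Qed.

Lemma cvg_gmom n : gmom n k%:R @[k --> \oo] --> (0 : R).
Proof.
apply/norm_cvg0P.
apply: (@squeeze_cvgr _ _ _ _ (fun=> 0)
  (fun k => (n.+1)`!%:R * gauss_fun (k%:R : R))).
- by near=> k; rewrite norm_gmom_le normr_ge0.
- exact: cvg_cst.
- rewrite -[X in _ --> X](mulr0 (n.+1)`!%:R); apply: cvgM; first exact: cvg_cst.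
  exact: (cvg_comp _ _ cvgr_idn cvg_gauss_fun).
Unshelve. all: by end_near. Qed.

Lemma cvgN_gmom n : gmom n (- k%:R) @[k --> \oo] --> (0 : R).
Proof.
under eq_cvg do rewrite gmomN.
have /(cvgMl_tmp (a := (-1) ^+ n)) := @cvg_gmom n.
by rewrite mulr0.
Qed.

Definition gmoment n : R := \int[mu]_s gmom n s.

Lemma has_int_gmom n : has_int mu (gmom n) (gmoment n).
Proof. by split => //; exact: integrable_gmom. Qed.

(** Integration by parts: the difference of the two sides is, up to sign, the integral of the
    derivative of s^n exp(- pi s^2). *)
Lemma gmomentS n : 2 * pi * gmoment n.+1 = n%:R * gmoment n.-1.
Proof.
apply/esym/eqP; rewrite -subr_eq0; apply/eqP.
have [_ <-] : has_int mu (fun s => n%:R * gmom n.-1 s - 2 * pi * gmom n.+1 s)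
  (n%:R * gmoment n.-1 - 2 * pi * gmoment n.+1).
  by apply: has_intB; apply: has_intZ; exact: has_int_gmom.
have [] // : has_int mu (fun s => n%:R * gmom n.-1 s - 2 * pi * gmom n.+1 s) 0.
apply: (has_int_derive0 (is_derive_gmom n)).
- by move=> s; apply: cvgB; apply: cvgM; (try exact: cvg_cst); exact: continuous_gmom.
- by apply: (has_intB (has_intZ _ (has_int_gmom _)) (has_intZ _ (has_int_gmom _))).1.
- exact: cvg_gmom.
- exact: cvgN_gmom.
Qed.

End GaussianMoments.

(** * Monomials times the Gaussian *)

Section RealDerivative.
Context {R : realType} {m : nat}.
Implicit Types (u v : 'rV[R[i]]_m) (f g : 'rV[R[i]]_m -> R[i]) (d : R[i]).

(** [real_derive] has a value even where no derivative exists; this relation also records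
    differentiability, on which the derivation rules depend. *)
Definition is_real_derive v f u d : Prop :=
  is_derive (0 : R) (1 : R) (fun t : R => complex.Re (f (u + t%:C *: v)))
    (complex.Re d) /\
  is_derive (0 : R) (1 : R) (fun t : R => complex.Im (f (u + t%:C *: v)))
    (complex.Im d).

Lemma is_real_derive_val v f u d : is_real_derive v f u d ->
  real_derive v f u = d.
Proof. by case: d => a b [? ?]; rewrite /real_derive !derive1E !derive_val. Qed.

Lemma is_real_derive_cst v c u : is_real_derive v (fun=> c) u 0.
Proof. by split; exact: is_derive_cst. Qed.

Lemma is_real_deriveD v f g u d d' : is_real_derive v f u d ->
  is_real_derive v g u d' -> is_real_derive v (fun w => f w + g w) u (d + d').
Proof.
move=> [fR fI] [gR gI]; split; rewrite raddfD; under eq_fun do rewrite raddfD;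
  exact: is_derive_addf.
Qed.

Lemma is_real_deriveZ v f u d c : is_real_derive v f u d ->
  is_real_derive v (fun w => c * f w) u (c * d).
Proof.
move=> [fR fI]; split.
  rewrite complex_ReM -mulNr; under eq_fun do [rewrite complex_ReM -mulNr].
  by apply: is_derive_addf; exact: is_derive_cmulf.
rewrite complex_ImM; under eq_fun do rewrite complex_ImM.
by apply: is_derive_addf; exact: is_derive_cmulf.
Qed.

End RealDerivative.

Section HermiteFunctions.
Context {R : realType} {m : nat}.
Local Notation U := 'rV[R[i]]_m.
Local Notation coordinate := (bool * 'I_m)%type.
Implicit Types (i : coordinate) (e : coordinate -> nat) (u : U) (f g : U -> R[i]).

(* (false, i) stands for Re z_i and (true, i) for Im z_i. *)
Definition rcoord i u : R :=
  if i.1 then complex.Im (u 0 i.2) else complex.Re (u 0 i.2).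

Definition rdir i : U :=
  if i.1 then 'i%C *: delta_mx 0 i.2 else delta_mx 0 i.2.

Lemma rcoord_line i j u (t : R) :
  rcoord i (u + t%:C *: rdir j) = rcoord i u + (i == j)%:R * t.
Proof.
case: i j => [b i] [c j]; rewrite /rcoord /rdir xpair_eqE /=.
case: b c => -[]; rewrite !mxE eqxx /=; case: (i == j) => /=;
  case: (u 0 i) => x y /=; ring.
Qed.

Definition set_exp e i n : coordinate -> nat :=
  fun j => if j == i then n else e j.

Lemma prod_set_exp (w : coordinate -> nat -> R) e i n :
  \prod_j w j (set_exp e i n j) = w i n * \prod_(j | j != i) w j (e j).
Proof.
rewrite (bigD1 i)//= /set_exp eqxx; congr (_ * _).
by apply: eq_bigr => j /negbTE ->.
Qed.

Definition hmono e u : R := \prod_i gmom (e i) (rcoord i u).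

Lemma is_real_derive_hmono i e u :
  is_real_derive (rdir i) (fun w => (hmono e w)%:C) u
    ((e i)%:R * hmono (set_exp e i (e i).-1) u -
       2 * pi * hmono (set_exp e i (e i).+1) u)%:C.
Proof.
split => /=; last exact: is_derive_cst.
rewrite /hmono !(prod_set_exp (fun j n => gmom n (rcoord j u))).
set K := \prod_(j | j != i) _.
have -> : (fun t => \prod_j gmom (e j) (rcoord j (u + t%:C *: rdir i))) =
          (fun t : R => K * gmom (e i) (rcoord i u + t)).
  apply/funext => t; rewrite (bigD1 i)//= rcoord_line eqxx mul1r mulrC.
  congr (_ * _); apply: eq_bigr => j /negbTE ji.
  by rewrite rcoord_line ji mul0r addr0.
have dt : is_derive (0 : R) (1 : R) (fun t : R => rcoord i u + t) 1.
  have d0 : is_derive (0 : R) 1 (fun _ : R => rcoord i u) 0 by exact: is_derive_cst.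
  have d1 : is_derive (0 : R) 1 (fun t : R => t) 1 by exact: is_derive_id.
  by apply: is_derive_eq (is_derive_addf d0 d1) _; rewrite add0r.
have dg := is_derive_gmom (e i) (rcoord i u).
rewrite -{1}[rcoord i u]addr0 in dg.
have d2 := is_derive_cmulf K (is_derive1_comp dg dt).
apply: is_derive_eq d2 _.
ring.
Qed.

(** Hermite creation operator in one real coordinate. The constant is 1/(2 pi) because a Wirtinger
    derivative is half a combination of two real ones. *)
Definition ladder i f u : R[i] :=
  (rcoord i u)%:C * f u - ((2 * pi)^-1)%:C * real_derive (rdir i) f u.

Lemma rcoord_hmono i e u :
  rcoord i u * hmono e u = hmono (set_exp e i (e i).+1) u.
Proof.
rewrite /hmono (prod_set_exp (fun j n => gmom n (rcoord j u))) (bigD1 i)//=.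
rewrite mulrA; congr (_ * _).
by rewrite /gmom (exprS _ (e i)) mulrA.
Qed.

(** The factor 2 arises because differentiating the Gaussian contributes the same term as
    multiplication by the coordinate. *)
Lemma ladder_hmono i e : ladder i (fun w => (hmono e w)%:C) =
  fun u => 2 * (hmono (set_exp e i (e i).+1) u)%:C
           - ((e i)%:R / (2 * pi))%:C * (hmono (set_exp e i (e i).-1) u)%:C.
Proof.
apply/funext => u; rewrite /ladder (is_real_derive_val (is_real_derive_hmono i e u)).
rewrite -rmorphM rcoord_hmono.
have pi0 : pi != 0 :> R by rewrite gt_eqF// pi_gt0.
have -> : 2 = 2%:C :> R[i] by rewrite rmorphMn rmorph1.
rewrite -!rmorphM -!rmorphB; congr (_%:C).
by move: pi pi0 => c c0; field; rewrite c0.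
Qed.

Variable P : pred 'I_m.

(** Complex span of the monomials in the coordinates selected by [P], times the full Gaussian. Its
    members are differentiable and stable under [ladder] in directions of [P], and linear statements
    about them follow by induction. *)
Inductive hspan : (U -> R[i]) -> Prop :=
| hspan0 : hspan (fun=> 0)
| hspan_cons c e f : (forall i, ~~ P i.2 -> e i = 0%N) -> hspan f ->
    hspan (fun u => c * (hmono e u)%:C + f u).

Lemma hspan1 c e : (forall i, ~~ P i.2 -> e i = 0%N) ->
  hspan (fun u => c * (hmono e u)%:C).
Proof.
move=> eP; have := hspan_cons c eP hspan0.
by under eq_fun do rewrite addr0.
Qed.

Lemma hspanD f g : hspan f -> hspan g -> hspan (fun u => f u + g u).
Proof.
move=> + hg; elim=> [|c e {}f eP hf ih]; first by under eq_fun do rewrite add0r.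
by under eq_fun do rewrite -addrA; exact: hspan_cons.
Qed.

Lemma hspanZ c f : hspan f -> hspan (fun u => c * f u).
Proof.
elim=> [|d e {}f eP hf ih]; first by under eq_fun do rewrite mulr0; exact: hspan0.
by under eq_fun do rewrite mulrDr mulrA; exact: hspan_cons.
Qed.

Lemma hspan_sum (I : Type) (r : seq I) (Q : pred I) (F : I -> U -> R[i]) :
  (forall k, Q k -> hspan (F k)) -> hspan (fun u => \sum_(k <- r | Q k) F k u).
Proof.
move=> FQ; elim: r => [|i r ih].
  by under eq_fun do rewrite big_nil; exact: hspan0.
under eq_fun do rewrite big_cons.
by case Qi: (Q i) => //; apply: hspanD => //; exact: FQ.
Qed.

Lemma hspan_derive i f u : hspan f ->
  is_real_derive (rdir i) f u (real_derive (rdir i) f u).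
Proof.
move=> hf; suff [d df] : exists d, is_real_derive (rdir i) f u d.
  by rewrite (is_real_derive_val df).
elim: hf => [|c e {}f eP _ [d fd]]; first by exists 0; exact: is_real_derive_cst.
eexists; apply: is_real_deriveD fd; apply: is_real_deriveZ.
exact: is_real_derive_hmono.
Qed.

Lemma ladder0 i : ladder i (fun=> 0) = fun=> 0.
Proof. by apply/funext => u; rewrite /ladder real_derive0 !mulr0 subr0. Qed.

(** Linearity of [ladder]; membership of f in [hspan] supplies the differentiability that additivity
    of the derivative needs. *)
Lemma ladder_cons i c e f : hspan f ->
  ladder i (fun u => c * (hmono e u)%:C + f u) =
  fun u => c * ladder i (fun w => (hmono e w)%:C) u + ladder i f u.
Proof.
move=> hf; apply/funext => u; rewrite /ladder.
rewrite (is_real_derive_val (is_real_deriveD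
  (is_real_deriveZ c (is_real_derive_hmono i e u)) (hspan_derive i u hf))).
rewrite (is_real_derive_val (is_real_derive_hmono i e u)); ring.
Qed.

Lemma set_expP e i n : (forall i, ~~ P i.2 -> e i = 0%N) -> P i.2 ->
  forall j, ~~ P j.2 -> set_exp e i n j = 0%N.
Proof.
move=> eP Pi j Pj; rewrite /set_exp; case: eqVneq => [ji|_]; last exact: eP.
by rewrite -ji (negbTE Pj) in Pi.
Qed.

Lemma hspan_ladder i f : P i.2 -> hspan f -> hspan (ladder i f).
Proof.
move=> Pi; elim=> [|c e {}f eP hf ih]; first by rewrite ladder0; exact: hspan0.
rewrite ladder_cons// ladder_hmono; apply: hspanD => //; apply: hspanZ.
under eq_fun do rewrite -mulNr.
by apply: hspanD; apply: hspan1; exact: set_expP.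
Qed.

End HermiteFunctions.

(** * Integration over an isotropic subspace *)

Section IsotropicIntegral.
Context {R : realType} {p q : nat}.
Hypothesis qp : (q < p)%N.
Local Notation U := 'rV[R[i]]_(p + q).
Local Notation R2 := (measurableTypeR R * measurableTypeR R)%type.
Local Notation coordinate := (bool * 'I_(p + q))%type.
Variable x : U.
Hypothesis xU : x \in Uprime R p q.

(** Positions of z_k and z_(m+1-k), the two coordinates in which e_k is nonzero; q < p puts the
    first among the positive ones. *)
Let lq (k : 'I_q) : 'I_(p + q) := lshift q (widen_ord (ltnW qp) k).
Let rq (k : 'I_q) : 'I_(p + q) := rshift p (rev_ord k).

Lemma Uprime_coord0 (i : 'I_(p + q)) : ~~ (q <= i < p)%N -> x 0 i = 0.
Proof.
move=> ni.
pose s := [seq (delta_mx 0 i : U) | i : 'I_(p + q) <- enum 'I_(p + q)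
            & (q <= i < p)%N].
have xs : x \in <<in_tuple s>>%VS := xU.
rewrite (coord_span xs).
rewrite summxE big1// => j _; rewrite mxE.
have : s`_j \in s by rewrite mem_nth.
rewrite /=; case/mapP => i'; rewrite mem_filter => /andP[ci' _] ->.
rewrite mxE eqxx /= (_ : _ == _ = false) ?mulr0//.
by apply/negbTE; apply: contra ni => /eqP ->.
Qed.

Definition isotropic_point (y : q.-tuple R2) : U :=
  \sum_(k < q) tocomplex (tnth y k) *: evec R p k + x.

Lemma isotropic_point_lq y k :
  isotropic_point y 0 (lq k) = ((Num.sqrt 2)^-1)%:C * tocomplex (tnth y k).
Proof.
rewrite mxE Uprime_coord0 ?addr0; last by rewrite /= leqNgt ltn_ord.
rewrite summxE (bigD1 k)//= big1 => [|l lk]; rewrite mxE evec_lshift//=.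
  by rewrite eqxx mulr1 addr0 mulrC.
by rewrite -val_eqE /= eq_sym in lk; rewrite (negbTE lk) !mulr0.
Qed.

Lemma isotropic_point_rq y k :
  isotropic_point y 0 (rq k) = ((Num.sqrt 2)^-1)%:C * tocomplex (tnth y k).
Proof.
rewrite mxE Uprime_coord0 ?addr0; last by rewrite /= ltnNge leq_addr andbF.
rewrite summxE (bigD1 k)//= big1 => [|l lk]; rewrite mxE evec_rshift//=.
  by rewrite eqxx mulr1 addr0 mulrC.
by rewrite (inj_eq rev_ord_inj) eq_sym (negbTE lk) !mulr0.
Qed.

Lemma isotropic_point_mid y (i : 'I_p) : (q <= i)%N ->
  isotropic_point y 0 (lshift q i) = x 0 (lshift q i).
Proof.
move=> qi; rewrite mxE summxE big1 ?add0r// => k _; rewrite mxE evec_lshift//.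
rewrite (_ : _ == _ = false) ?mulr0//; apply/negbTE; rewrite neq_ltn orbC.
by rewrite (leq_trans (ltn_ord k)).
Qed.

(** The regrouping pairs [lq k] with [rq k], since at an isotropic point both depend on the same
    y_k, and isolates the middle coordinates, which depend on x alone. *)
Lemma big_coordinate (F : coordinate -> R) :
  \prod_i F i =
  (\prod_(i < p | (q <= i)%N) (F (true, lshift q i) * F (false, lshift q i))) *
  \prod_(k < q) (F (true, lq k) * F (true, rq k) *
                 (F (false, lq k) * F (false, rq k))).
Proof.
have -> : \prod_i F i = \prod_(i < p + q) (F (true, i) * F (false, i)).
  rewrite (eq_bigr (fun i => F (i.1, i.2))) => [|[]//].
  rewrite -(pair_big xpredT xpredT (fun b i => F (b, i)))/=.
  by rewrite big_bool/= -big_split.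
rewrite big_split_ord/= (bigID (fun i : 'I_p => (q <= i)%N))/= -mulrA.
congr (_ * _); under [X in X * _]eq_bigl do rewrite -ltnNge.
rewrite [X in X * _](big_ord_narrow (ltnW qp)) [X in _ * X](reindex_inj rev_ord_inj).
rewrite -big_split/=; apply: eq_bigr => k _.
by rewrite mulrACA.
Qed.

(* The coordinates k and m+1-k both involve y_k: the Gaussian of the second  *)
(* one is merged into the factor of the first, hence its own weight 1.        *)
Definition iweight (i : coordinate) n : R :=
  if (i.2 < q)%N then (Num.sqrt 2)^-1 ^+ n * gmoment n
  else if (i.2 < p)%N then gmom n (rcoord i x) else 1.

(** The two half-weight Gaussians at s / sqrt 2 multiply to exp(- pi s^2). *)
Lemma gmom_scaled n (s : R) :
  gmom n ((Num.sqrt 2)^-1 * s) * gmom 0 ((Num.sqrt 2)^-1 * s) =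
  (Num.sqrt 2)^-1 ^+ n * gmom n s.
Proof.
rewrite /gmom expr0 mul1r exprMn -!mulrA -expRD; congr (_ * (_ * expR _)).
rewrite exprMn exprVn sqr_sqrtr ?ler0n//.
by move: pi => c; field.
Qed.

(** With no power of a negative coordinate present, the restricted monomial is a constant times a
    product of functions of the separate real variables Re y_k and Im y_k, so Fubini applies. *)
Lemma has_cint_hmono (e : coordinate -> nat) :
  (forall i : coordinate, ~~ (i.2 < p)%N -> e i = 0%N) ->
  has_cint (power_measure (@lebesgue_complex R) q)
    (fun y => (hmono e (isotropic_point y))%:C) (\prod_i iweight i (e i))%:C.
Proof.
move=> e0.
pose c := \prod_(i < p | (q <= i)%N)
  (gmom (e (true, lshift q i)) (rcoord (true, lshift q i) x) *
   gmom (e (false, lshift q i)) (rcoord (false, lshift q i) x)).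
pose r b k := (Num.sqrt 2)^-1 ^+ e (b, lq k) : R.
have pE y : hmono e (isotropic_point y) = c * \prod_(k < q)
   (r true k * gmom (e (true, lq k)) (tnth y k).2 *
    (r false k * gmom (e (false, lq k)) (tnth y k).1)).
  rewrite /hmono big_coordinate; congr (_ * _).
    by apply: eq_bigr => i qi; rewrite /rcoord/= isotropic_point_mid.
  apply: eq_bigr => k _; rewrite /rcoord/= isotropic_point_lq isotropic_point_rq.
  rewrite (e0 (true, rq k)) ?(e0 (false, rq k)) /= -?leqNgt ?leq_addr//.
  by rewrite !mul0r subr0 addr0 !gmom_scaled.
have vE : \prod_i iweight i (e i) = c * \prod_(k < q)
   (r true k * gmoment (e (true, lq k)) * (r false k * gmoment (e (false, lq k)))).
  rewrite big_coordinate; congr (_ * _).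
    by apply: eq_bigr => i qi; rewrite /iweight/= ltnNge qi/= ltn_ord.
  apply: eq_bigr => k _; rewrite /iweight/= ltn_ord.
  rewrite !ltnNge (leq_trans (ltnW qp)) ?leq_addr//=.
  by rewrite !mulr1.
rewrite vE; under eq_fun do rewrite pE.
rewrite rmorphM; under eq_fun do rewrite rmorphM.
apply: has_cintZ.
pose f k (z : R2) : R := r true k * gmom (e (true, lq k)) z.2 *
  (r false k * gmom (e (false, lq k)) z.1).
pose v k : R := r true k * gmoment (e (true, lq k)) *
  (r false k * gmoment (e (false, lq k))).
have fv k : has_cint (@lebesgue_complex R) (fun z => (f k z)%:C) (v k)%:C.
  apply: has_cint_real; rewrite /v mulrC.
  rewrite (_ : f k = fun z : R2 => (r false k * gmom (e (false, lq k)) z.1) *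
    (r true k * gmom (e (true, lq k)) z.2)); last by apply/funext => z; rewrite /f mulrC.
  have h b := has_intZ (r b k) (has_int_gmom (R := R) (e (b, lq k))).
  exact: (has_int_prod (m1 := @lebesgue_measure R) (m2 := @lebesgue_measure R)
    (h false) (h true)).
have := @has_cint_big_prod _ _ _ (@lebesgue_complex R) q _ _ fv.
by under eq_fun do rewrite -rmorph_prod; rewrite -rmorph_prod.
Qed.

(** The cancellation behind the theorem: [gmomentS] expresses the moment of order n+1 by that of
    order n-1, and 2 (1 / sqrt 2)^2 = 1 makes the coefficients agree. *)
Lemma iweight_ladder (i : coordinate) n : (i.2 < q)%N ->
  2 * iweight i n.+1 - n%:R / (2 * pi) * iweight i n.-1 = 0.
Proof.
rewrite /iweight => ->; have := @gmomentS R n.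
have : (Num.sqrt 2)^-1 ^+ 2 = 2^-1 :> R by rewrite exprVn sqr_sqrtr ?ler0n.
have : (pi : R) != 0 by rewrite gt_eqF// pi_gt0.
move: (Num.sqrt 2)^-1 pi => c w w0 c2 H.
have {}H : gmoment n.+1 = n%:R / (2 * w) * @gmoment R n.-1.
  apply: (@mulfI _ (2 * w)); first by rewrite mulf_neq0 ?pnatr_eq0.
  by rewrite H; field.
rewrite H; case: n H => [|n] _ /=; first by ring.
by rewrite exprS exprS (mulrA c) -expr2 c2; field.
Qed.

Definition positive_index : pred 'I_(p + q) := fun i => (i < p)%N.

Lemma has_cint_hspan f : hspan positive_index f ->
  exists I, has_cint (power_measure (@lebesgue_complex R) q)
    (fun y => f (isotropic_point y)) I.
Proof.
elim=> [|c e {}f eP _ [I fI]]; first by exists 0; exact: has_cint0.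
by eexists; apply: has_cintD fI; apply: has_cintZ; exact: has_cint_hmono.
Qed.

Lemma has_cint_ladder (i : coordinate) f : (i.2 < q)%N -> hspan positive_index f ->
  has_cint (power_measure (@lebesgue_complex R) q)
    (fun y => ladder i f (isotropic_point y)) 0.
Proof.
move=> iq; have ip : (i.2 < p)%N := ltn_trans iq qp.
elim=> [|c e {}f eP hf ih]; first by rewrite ladder0; exact: has_cint0.
rewrite (ladder_cons _ _ _ hf) ladder_hmono.
rewrite -[X in has_cint _ _ X]addr0 -{1}(mulr0 c).
apply: has_cintD ih; apply: has_cintZ.
have se n := has_cint_hmono (set_expP (P := positive_index) n eP ip).
have := has_cintD (has_cintZ 2 (se (e i).+1))
  (has_cintZ (- ((e i)%:R / (2 * pi))%:C) (se (e i).-1)).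
under eq_fun do rewrite mulNr.
(* The two terms differ only in the exponent at [i]; the weights of all other coordinates form the
   common factor [K]. *)
rewrite !prod_set_exp mulNr.
set K := \prod_(j | j != i) _.
have -> : 2 = 2%:C :> R[i] by rewrite rmorphMn rmorph1.
rewrite -!rmorphM -rmorphB !mulrA -mulrBl iweight_ladder// mul0r.
by [].
Qed.

End IsotropicIntegral.

(** * Coefficients of the Kudla-Millson form *)

Section FormCoefficients.
Context {R : realType} {p q : nat}.
Local Notation U := 'rV[R[i]]_(p + q).
Local Notation gens := ('I_p * 'I_q + 'I_p * 'I_q)%type.
Local Notation Lam := (extalg R[i] gens).
Local Notation posc := (@positive_index p q).
Implicit Types (f : U -> R[i]) (g : U -> Lam) (A B : {set gens}).

(** Both conj z and 2 d/dz have the shape (real part) - i (imaginary part), so the operator splits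
    into two real creation operators. *)
Lemma raiseE (j : 'I_p) f : raise j f = fun u : U =>
  ladder (false, lshift q j) f u + (- 'i%C) * ladder (true, lshift q j) f u.
Proof.
apply/funext => u; rewrite /raise /partial_z /ladder /rcoord /rdir /=.
rewrite /partial_re /partial_im.
have -> : (u 0 (lshift q j))^*%C = (complex.Re (u 0 (lshift q j)))%:C
   - 'i%C * (complex.Im (u 0 (lshift q j)))%:C.
  by case: (u 0 (lshift q j)) => a b; simpc.
have -> : ((2 * pi)^-1)%:C = 2^-1 * (pi^-1)%:C :> R[i].
  by rewrite invfM rmorphM /= fmorphV rmorph_nat.
set a := real_derive _ _ _; set b := real_derive _ _ _.
move: a b (f u) (complex.Re _)%:C (complex.Im _)%:C (pi^-1)%:C 'i%C => a b c d e h i.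
by field.
Qed.

Lemma raisebarE (j : 'I_p) f : raisebar j f = fun u : U =>
  ladder (false, lshift q j) f u + 'i%C * ladder (true, lshift q j) f u.
Proof.
apply/funext => u; rewrite /raisebar /partial_zbar /ladder /rcoord /rdir /=.
rewrite /partial_re /partial_im.
have {1}-> : u 0 (lshift q j) = (complex.Re (u 0 (lshift q j)))%:C
   + 'i%C * (complex.Im (u 0 (lshift q j)))%:C.
  by case: (u 0 (lshift q j)) => a b; simpc.
have -> : ((2 * pi)^-1)%:C = 2^-1 * (pi^-1)%:C :> R[i].
  by rewrite invfM rmorphM /= fmorphV rmorph_nat.
set a := real_derive _ _ _; set b := real_derive _ _ _.
move: a b (f u) (complex.Re _)%:C (complex.Im _)%:C (pi^-1)%:C 'i%C => a b c d e h i.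
by field.
Qed.

Lemma hspan_raise j f : hspan posc f -> hspan posc (raise j f).
Proof.
move=> hf; rewrite raiseE.
by apply: hspanD; [|apply: hspanZ]; apply: hspan_ladder hf; exact: (ltn_ord j).
Qed.

Lemma hspan_raisebar j f : hspan posc f -> hspan posc (raisebar j f).
Proof.
move=> hf; rewrite raisebarE.
by apply: hspanD; [|apply: hspanZ]; apply: hspan_ladder hf; exact: (ltn_ord j).
Qed.

Lemma gaussE : @gauss R p q = fun u => (hmono (fun=> 0%N) u)%:C.
Proof.
apply/funext => u; rewrite /gauss /hmono; congr (_%:C).
rewrite mulr_sumr expR_sum.
rewrite (eq_bigr (fun i => gmom 0 (rcoord (i.1, i.2) u))) => [|[]//].
rewrite -(pair_big xpredT xpredT (fun b i => gmom 0 (rcoord (b, i) u)))/=.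
rewrite big_bool/= -big_split; apply: eq_bigr => i _.
by rewrite /rcoord /gmom /= !expr0 !mul1r -expRD mulrDr addrC.
Qed.

Definition hspan_form g := forall A, hspan posc (fun u => g u A).

(** Records that a generator has not yet been introduced, so that only one later operator can
    account for its presence. *)
Definition omits_gen (i0 : gens) g := forall u A, i0 \in A -> g u A = 0.

Lemma hspan_form_op x P g : (forall f, hspan posc f -> hspan posc (P f)) ->
  hspan_form g -> hspan_form (ext_op x P g).
Proof.
move=> hP hg A; rewrite /ext_op /wedge; under eq_fun do rewrite ffunE.
apply: hspan_sum => B _; apply: hspanZ; under eq_fun do rewrite ffunE.
exact: hP.
Qed.

Lemma omits_gen_op i0 i P g : P (fun=> 0) = (fun=> 0) -> i != i0 ->
  omits_gen i0 g -> omits_gen i0 (ext_op (ext_gen i) P g).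
Proof.
move=> P0 ii0 hg u A iA; rewrite /ext_op /wedge ffunE big1// => B BA.
rewrite !ffunE; have [->|] := eqVneq B [set i]%SET; last by rewrite mulr0 mul0r.
rewrite (_ : (fun v => g v _) = fun=> 0) ?P0 ?mulr0//.
by apply/funext => v; apply: hg; rewrite !inE eq_sym ii0.
Qed.

Lemma hspan_form_sum (J : finType) (F : J -> U -> Lam) :
  (forall j, hspan_form (F j)) -> hspan_form (fun u => \sum_j F j u).
Proof.
move=> hF A; under eq_fun do rewrite sum_ffunE.
by apply: hspan_sum => j _; exact: hF.
Qed.

Lemma omits_gen_sum i0 (J : finType) (F : J -> U -> Lam) :
  (forall j, omits_gen i0 (F j)) -> omits_gen i0 (fun u => \sum_j F j u).
Proof. by move=> hF u A iA; rewrite sum_ffunE big1// => j _; exact: hF. Qed.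

Lemma hspan_formZ c g : hspan_form g -> hspan_form (fun u => c *: g u).
Proof. by move=> hg A; under eq_fun do rewrite ffunE; exact: hspanZ. Qed.

Lemma omits_genZ i0 c g : omits_gen i0 g -> omits_gen i0 (fun u => c *: g u).
Proof. by move=> hg u A iA; rewrite ffunE hg// scaler0. Qed.

Lemma big_comp_ind (Q : (U -> Lam) -> Prop) n
    (F : 'I_n -> (U -> Lam) -> U -> Lam) g :
  (forall k h, Q h -> Q (F k h)) -> Q g ->
  Q ((\big[(fun F G => F \o G)/idfun]_(k < n) F k) g).
Proof.
move=> hF hg; elim: (index_enum _) => [|k r ih]; first by rewrite big_nil.
by rewrite big_cons; exact: hF.
Qed.

Definition gauss_form (u : U) : Lam := gauss u *: ext_one.

Lemma hspan_gauss_form : hspan_form gauss_form.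
Proof.
move=> A; rewrite /gauss_form gaussE.
under eq_fun do rewrite ffunE /GRing.scale /= mulrC.
exact: hspan1.
Qed.

Lemma hspan_Dplusbar g : hspan_form g -> hspan_form (Dplusbar g).
Proof.
move=> hg; apply: hspan_formZ; apply: (big_comp_ind (Q := hspan_form)) => // k h hh.
by apply: hspan_form_sum => j; apply: hspan_form_op => // f; exact: hspan_raisebar.
Qed.

Lemma omits_gen_Dplusbar jk g :
  omits_gen (inl jk) g -> omits_gen (inl jk) (Dplusbar g).
Proof.
move=> hg; apply: omits_genZ.
apply: (big_comp_ind (Q := omits_gen (inl jk))) => // k h hh.
by apply: omits_gen_sum => j; apply: omits_gen_op => //; exact: raisebar0.
Qed.

Lemma omits_gen_gauss_form i0 : omits_gen i0 gauss_form.
Proof.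
move=> u A iA; rewrite !ffunE (_ : A == _ = false) ?scaler0//.
by apply/negbTE; apply: contraTneq iA => ->; rewrite inE.
Qed.

Lemma hspan_phi_qq : hspan_form (@phi_qq R p q).
Proof.
apply: hspan_formZ; apply: (big_comp_ind (Q := hspan_form)) => [k h hh|].
  by apply: hspan_form_sum => j; apply: hspan_form_op => // f; exact: hspan_raise.
by apply: hspan_Dplusbar; exact: hspan_gauss_form.
Qed.

End FormCoefficients.

(** * Vanishing integrals of the coefficients that contain xi_11 *)

Section Vanishing.
Context {R : realType} {p q : nat}.
Hypothesis qp : (q.+1 < p)%N.
Local Notation U := 'rV[R[i]]_(p + q.+1).
Local Notation gens := ('I_p * 'I_q.+1 + 'I_p * 'I_q.+1)%type.
Local Notation Lam := (extalg R[i] gens).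
Local Notation posc := (@positive_index p q.+1).
Local Notation mu := (power_measure (@lebesgue_complex R) q.+1).
Variable x : U.
Hypothesis xU : x \in Uprime R p q.+1.

Let j0 : 'I_p := Ordinal (leq_ltn_trans (leq0n _) qp).
Definition xi00 : gens := inl (j0, ord0).

Lemma has_cint_raise f : hspan posc f ->
  has_cint mu (fun y => raise j0 f (isotropic_point x y)) 0.
Proof.
move=> hf; rewrite raiseE -[X in has_cint _ _ X]addr0.
by apply: has_cintD; [|apply: has_cintZ0]; exact: (has_cint_ladder qp).
Qed.

(* The factor k = 0 of Dplus is applied last, so the coefficient on A is      *)
(* the raising operator of index (0, 0) applied to a single coefficient.      *)
Lemma has_cint_phi_qq0 (A : {set gens}) : xi00 \in A ->
  has_cint mu (fun y => phi_qq (isotropic_point x y) A) 0.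
Proof.
move=> iA; rewrite /phi_qq /Dplus; under eq_fun do rewrite ffunE.
apply: has_cintZ0.
pose F k (h : U -> Lam) v := \sum_(j < p) ext_op (xi R j k) (raise j) h v.
pose g := (\big[(fun F G => F \o G)/idfun]_(k < q) F (lift ord0 k))
  (Dplusbar (@gauss_form R p q.+1)).
rewrite big_ord_recl.
suff : has_cint mu (fun y => F ord0 g (isotropic_point x y) A) 0 by [].
have hg : hspan_form g.
  apply: (big_comp_ind (Q := hspan_form)) => [k h hh|].
    by apply: hspan_form_sum => j; apply: hspan_form_op => // f; exact: hspan_raise.
  by apply: hspan_Dplusbar; exact: hspan_gauss_form.
(* The factors with k >= 1 introduce generators of second index k, and [Dplusbar] only conjugate
   ones, so [xi00] does not occur in [g]. *)
have og : omits_gen xi00 g.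
  apply: (big_comp_ind (Q := omits_gen xi00)) => [k h hh|].
    apply: omits_gen_sum => j; apply: omits_gen_op => //; first exact: raise0.
    by apply/eqP => /(congr1 (fun s => if s is inl jk then val jk.2 else 0%N)).
  by apply: omits_gen_Dplusbar; exact: omits_gen_gauss_form.
rewrite /F; under eq_fun do rewrite sum_ffunE.
apply: has_cint_sum0 => j _; rewrite /ext_op /wedge; under eq_fun do rewrite ffunE.
apply: has_cint_sum0 => B BA.
under eq_fun do rewrite [X in _ * X]ffunE.
have [Bj|Bj] := eqVneq B [set inl (j, ord0)]%SET; last first.
  rewrite [xi _ _ _ B]ffunE (negbTE Bj) !mulr0; under eq_fun do rewrite mul0r.
  exact: has_cint0.
apply: has_cintZ0; have [->|jj0] := eqVneq j j0; first exact: has_cint_raise.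
(* For j other than [j0], removing the generator (j, 0) leaves [xi00] in the index set, where [g]
   vanishes. *)
rewrite (_ : (fun v => g v _) = fun=> 0) ?raise0; first exact: has_cint0.
apply/funext => v; apply: og; rewrite Bj !inE iA andbT.
by apply: contra jj0 => /eqP[->].
Qed.

(** Coefficients without [xi00] may have any integral, but Fubini needs them integrable; this is the
    hypothesis of [has_cint_big_wedge]. *)
Lemma has_cint_phi_qq (A : {set gens}) : exists I : R[i],
  has_cint mu (fun y => phi_qq (isotropic_point x y) A) I /\ (xi00 \in A -> I = 0).
Proof.
have [I hI] := has_cint_hspan qp xU (@hspan_phi_qq R p q.+1 A).
exists I; split=> // iA; case: hI => _ <-.
by case: (has_cint_phi_qq0 iA).
Qed.

End Vanishing.

(** * Fubini for coefficients of wedge products *)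

Section WedgePower.
Context {R : realType} {d} {T : measurableType d} {I : finType}.
Variable mu : {sigma_finite_measure set T -> \bar R}.
Variable i0 : I.
Local Notation Lam := (extalg R[i] I).

(** A coefficient of the wedge is a signed sum over splittings of A into B and its complement in A.
    If [i0] is in A it lies in one of the two parts, so each product of integrals has a zero
    factor. *)
Lemma has_cint_big_wedge n (F : 'I_n -> T -> Lam) :
  (forall j A, exists c, has_cint mu (fun y => F j y A) c /\ (i0 \in A -> c = 0)) ->
  forall A, exists c, has_cint (power_measure mu n)
    (fun y => (\big[wedge/ext_one]_(j < n) F j (tnth y j)) A) c /\ (i0 \in A -> c = 0).
Proof.
elim: n F => [|n ih] F hF A.
  exists (@ext_one R[i] I A); split.
    under eq_fun do rewrite big_ord0.
    exact: (has_cint_power0 _ (fun=> ext_one A)).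
  move=> iA; rewrite ffunE (_ : A == _ = false)//.
  by apply/negbTE; apply: contraTneq iA => ->; rewrite inE.
(* Choice turns the integrals into functions of the index set, so that their sum over B can be
   written. *)
have [c hc] := choice (hF ord0).
have [c' hc'] := choice (ih _ (fun j => hF (lift ord0 j))).
exists (\sum_(B : {set I} | B \subset A) (-1) ^+ inversions B (A :\: B) *
  (c B * c' (A :\: B)%SET)); split.
  have E (y : n.+1.-tuple T) : (\big[wedge/ext_one]_(j < n.+1) F j (tnth y j)) A =
      \sum_(B : {set I} | B \subset A) (-1) ^+ inversions B (A :\: B) *
        (F ord0 (thead y) B *
         (\big[wedge/ext_one]_(j < n)
            F (lift ord0 j) (tnth [tuple of behead y] j)) (A :\: B)).
    rewrite big_ord_recl ffunE; apply: eq_bigr => B _; rewrite mulrA.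
    by under [in RHS]eq_bigr do rewrite tnth_behead_tuple.
  under eq_fun do rewrite E.
  apply: has_cint_sum => B _; apply: has_cintZ.
  exact: (has_cint_cons (hc B).1 (hc' (A :\: B)%SET).1).
move=> iA; rewrite big1// => B _; have [iB|iB] := boolP (i0 \in B).
  by rewrite (hc B).2// mul0r mulr0.
by rewrite (hc' _).2 ?mulr0// !inE iB.
Qed.

End WedgePower.

Theorem theorem5p1 (R : realType) (p q : nat) (q_gt0 : (1 <= q)%N)
    (q_lt_p : (q < p)%N) (x : 'I_p -> 'rV[R[i]]_(p + q))
    (x_in_Uprime : forall j : 'I_p, x j \in Uprime R p q) :
  cintegrable (lebesgue_Cqp p q) (ikeda_integrand (@phiKM R p q) x) /\
  cintegral (lebesgue_Cqp p q) (ikeda_integrand (@phiKM R p q) x) = 0.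
Proof.
(* Writing q as a successor provides the index k = 0, hence the generator [xi00], which belongs to
   the full index set. *)
case: q q_gt0 q_lt_p x x_in_Uprime => // q _ qp x xU.
have [c [hc /(_ (finset.in_setT _)) c0]] := has_cint_big_wedge
  (fun j A => has_cint_phi_qq qp (xU j) A) finset.setT.
rewrite {}c0 in hc.
(* [phiKM] is the top coefficient divided by this constant. *)
have := has_cintZ (wedge (omega R p q.+1) (omegabar R p q.+1) finset.setT)^-1 hc.
rewrite mulr0; under eq_fun do rewrite mulrC.
exact.
Qed.
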